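(* Let $E=\langle E(n)\mid n\in\mathbb{N}\rangle$ be a sequence of positive real numbers such that $\lim_{n\to\infty}E(n)=0$ and $\sum_{n=0}^\infty E(n)=\infty$, and let $r\geq 0$ be real. Then the sequence $r+E=\langle r+E(n)\mid n\in\mathbb{N}\rangle$ is dense-expandable.
   Context: A sequence $A=\langle A(n)\mid n\in\mathbb{N}\rangle$ of positive reals is dense-expandable if the set $X(A)=\{\sum_{n\in S}\varepsilon_n A(n) : S \text{ a finite subset of } \mathbb{N},\ \varepsilon_n\in\{-1,1\}\}$ is dense in $\mathbb{R}$. *)

(* Defs.v *)
From mathcomp Require Import all_boot all_order all_algebra.
From mathcomp Require Import finmap.
From mathcomp Require Import all_classical all_reals all_analysis.

Set Implicit Arguments.
Unset Strict Implicit.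
Unset Printing Implicit Defensive.

Import Order.TTheory GRing.Theory Num.Theory.
Import numFieldNormedType.Exports.

Local Open Scope classical_set_scope.
Local Open Scope ring_scope.

(* The signs [eps n] are only constrained on the finite index set [S]. *)
Definition signed_sums (R : realType) (A : R^nat) : set R :=
  [set x | exists (S : {fset nat}) (eps : nat -> R),
    (forall n, n \in S -> eps n = -1 \/ eps n = 1) /\
    x = \sum_(n <- S) eps n * A n].

Definition dense_expandable (R : realType) (A : R^nat) : Prop :=
  (forall n, 0 < A n) /\ dense (signed_sums A).

(* Main.v *)
(** Adding a constant [r] is invisible to signed sums with as many plus signs as
    minus signs.  A nonnegative target is first approximated by the sum of a block
    of [k] consecutive terms of [E], taken where the terms are small (partial sums
    grow unboundedly in small steps).  Then [k] later terms of [E], whose sum is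
    negligible, are subtracted to balance the signs. *)
Require Import Defs.
From mathcomp Require Import all_boot all_order all_algebra.
From mathcomp Require Import finmap.
From mathcomp Require Import all_classical all_reals all_analysis.
From mathcomp Require Import lra.
Import Order.TTheory GRing.Theory Num.Theory.
Import numFieldNormedType.Exports.
Local Open Scope classical_set_scope.
Local Open Scope ring_scope.

(** Lets the index set be given as a concatenation of intervals: a list without repetition is a
    permutation of the finite set it spans. *)
Lemma signed_sums_seq (R : realType) (A : R^nat) (s : seq nat) (eps : nat -> R) :
  uniq s -> (forall n, eps n = -1 \/ eps n = 1) ->
  signed_sums A (\sum_(n <- s) eps n * A n).
Proof.
move=> s_uniq eps1; exists [fset n in s]%fset, eps; split=> [n _|]; first exact: eps1.
by apply: perm_big; apply: uniq_perm => [||n]; rewrite ?fset_uniq// !inE.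
Qed.

Lemma signed_sums_opp (R : realType) (A : R^nat) (x : R) :
  signed_sums A x -> signed_sums A (- x).
Proof.
move=> [S [eps [eps1 ->]]]; exists S, (fun n => - eps n); split=> [n /eps1[]->|].
- by right; rewrite opprK.
- by left.
- by rewrite -sumrN; apply: eq_bigr => n _; rewrite mulNr.
Qed.

(** The bound [N + k <= M] makes the blocks disjoint, and since both have [k] terms their
    contributions [r *+ k] cancel. *)
Lemma signed_sums_blocks {R : realType} {r : R} (E : R^nat) {N M k : nat} :
  (N + k <= M)%N ->
  signed_sums (fun n => r + E n)
    (\sum_(N <= n < N + k) E n - \sum_(M <= n < M + k) E n).
Proof.
move=> NkM; pose eps n : R := if (n < M)%N then 1 else -1.
have -> : \sum_(N <= n < N + k) E n - \sum_(M <= n < M + k) E n =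
    \sum_(n <- index_iota N (N + k) ++ index_iota M (M + k)) eps n * (r + E n).
  rewrite big_cat /=.
  have -> : \sum_(N <= n < N + k) eps n * (r + E n) =
      r *+ k + \sum_(N <= n < N + k) E n.
    rewrite -[k in r *+ k](addKn N) -sumr_const_nat -big_split /=.
    apply: eq_big_nat => n /andP[_ nNk].
    by rewrite /eps (leq_trans nNk NkM) mul1r.
  have -> : \sum_(M <= n < M + k) eps n * (r + E n) =
      - (r *+ k + \sum_(M <= n < M + k) E n).
    rewrite -[k in r *+ k](addKn M) -sumr_const_nat -big_split /= -sumrN.
    apply: eq_big_nat => n /andP[Mn _].
    by rewrite /eps ltnNge Mn mulN1r.
  by rewrite opprD addrACA subrr add0r.
apply: signed_sums_seq => [|n]; last by rewrite /eps; case: ifP; [right|left].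
rewrite cat_uniq !iota_uniq andbT /=.
apply/hasPn => n; rewrite !mem_index_iota => /andP[Mn _].
by rewrite negb_and -!leqNgt (leq_trans NkM Mn) orbT.
Qed.

(** The least [k] whose block sum reaches [x] works: without its last term the sum is still below
    [x], and that term is less than [d]. *)
Lemma block_sum_approx {R : realType} {E : R^nat} {N : nat} {x d : R} :
  series E n @[n --> \oo] --> +oo ->
  (forall n, (N <= n)%N -> E n < d) -> 0 <= x -> 0 < d ->
  exists k, x <= \sum_(N <= n < N + k) E n < x + d.
Proof.
move=> sumE Ed x0 d0.
have reach : exists k, x <= \sum_(N <= n < N + k) E n.
  (* A block sum is a difference of partial sums, so it suffices that some partial sum past [N]
     reaches [x + series E N]. *)
  have [K _ /(_ (N + K)%N (leq_addl _ _)) /= Kx] :=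
    (cvgryPge _).1 sumE (x + series E N).
  by exists K; rewrite -sub_series_geq ?leq_addr// lerBrDr.
case: (ex_minnP reach) => -[|k] xk kmin; [exists 0%N|exists k.+1]; rewrite xk /=.
  (* Empty block: its sum 0 is below [x + d] because [0 <= x]. *)
  by rewrite addn0 big_geq// ltr_wpDl.
rewrite addnS big_nat_recr ?leq_addr//= ltrD ?Ed ?leq_addr//.
by rewrite ltNge; apply/negP => /kmin; rewrite ltnn.
Qed.

Lemma signed_sums_approx_ge0 {R : realType} {E : R^nat} (r : R) {x e : R} :
  (forall n, 0 < E n) -> E n @[n --> \oo] --> 0 ->
  series E n @[n --> \oo] --> +oo -> 0 <= x -> 0 < e ->
  exists2 y, signed_sums (fun n => r + E n) y & `|x - y| < e.
Proof.
move=> E_gt0 E0 sumE x0 e0.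
have small d : 0 < d -> exists N, forall n, (N <= n)%N -> E n < d.
  move=> /(cvgr0_norm_lt _ E0)[N _ NE]; exists N => n Nn.
  by rewrite (le_lt_trans (ler_norm _))// NE.
have [N NE] := small _ e0.
have [k /andP[xk kxe]] := block_sum_approx sumE NE x0 e0.
(* The threshold depends on [k]: [k] terms below [e / k.+1] add up to less than [e], and the
   successor also covers [k = 0]. *)
have [M ME] : exists M, forall n, (M <= n)%N -> E n < e / k.+1%:R.
  by apply: small; rewrite divr_gt0.
(* [M'] lies past both the first block and the threshold [M]. *)
set M' := (N + k + M)%N.
exists (\sum_(N <= n < N + k) E n - \sum_(M' <= n < M' + k) E n).
  by apply: signed_sums_blocks; rewrite leq_addr.
have tail_ge0 : 0 <= \sum_(M' <= n < M' + k) E n.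
  by apply: sumr_ge0 => n _; exact: ltW.
have tail_lt : \sum_(M' <= n < M' + k) E n < e.
  apply: (@le_lt_trans _ _ (e / k.+1%:R *+ k)).
    rewrite -[k in _ *+ k](addKn M') -sumr_const_nat.
    apply: ler_sum_nat => n /andP[M'n _].
    by apply/ltW/ME; rewrite (leq_trans _ M'n)// leq_addl.
  rewrite -mulr_natr mulrAC ltr_pdivrMr ?ltr0n//.
  by rewrite ltr_pM2l// ltr_nat.
(* The first block sum is in [[x, x + e[] and the second in [[0, e[], so their difference is within
   [e] of [x]. *)
by rewrite ltr_norml; apply/andP; split; lra.
Qed.

Theorem theorem4 (R : realType) (E : R^nat) (r : R)
    (E_gt0 : forall n, 0 < E n)
    (E_cvg0 : E n @[n --> \oo] --> 0)
    (sumE : series E n @[n --> \oo] --> +oo)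
    (r_ge0 : 0 <= r) :
  dense_expandable (fun n => r + E n).
Proof.
split=> [n|O [x Ox] Oopen]; first exact: ltr_wpDl.
have /nbhs_ballP[e /= e0 xeO] : nbhs x O by exact: open_nbhs_nbhs.
suff [y Xy xy] : exists2 y, signed_sums (fun n => r + E n) y & `|x - y| < e.
  by exists y; split=> //; exact: xeO.
have [x0|/ltW x0] := leP 0 x; first exact: signed_sums_approx_ge0.
(* For a negative target, approximate [- x] and flip all signs. *)
have Nx0 : 0 <= - x by rewrite oppr_ge0.
have [y Xy xy] := signed_sums_approx_ge0 r E_gt0 E_cvg0 sumE Nx0 e0.
exists (- y); first exact: signed_sums_opp.
by rewrite opprK -normrN opprD.
Qed.
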